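(* Let $L>0$, let $u(x)=\sum_{j=1}^{J}\alpha_j 1_{\Omega_j}(x)$ for $x\in\mathbb{R}^2$, where $\alpha_j\in\mathbb{C}$ and the sets $\Omega_j\subseteq[-L/2,L/2)^2$ are pairwise disjoint (the expression using the smallest possible number of characteristic functions), and let $v\in\mathcal{V}_2$ be the array $v[k]=\widehat{u}(k/L)$, $k\in\mathbb{O}$. Let $\mathcal{H}(\Lambda v)\in\mathbb{C}^{2M_1\times M_2}$ be the two-fold Hankel matrix of $\Lambda v=(\Lambda_1 v,\Lambda_2 v)$ associated with the $K_1\times K_2$ rectangular grid $\mathbb{K}$, and assume that $\operatorname{rank}(\mathcal{H}(\Lambda v))=r<\min\{2M_1,M_2\}$. Let $\mathcal{H}(\Lambda v)=X\Sigma Y^*$ be a full singular value decomposition ($X\in\mathbb{C}^{2M_1\times 2M_1}$ and $Y\in\mathbb{C}^{M_2\times M_2}$ unitary, $\Sigma\in\mathbb{C}^{2M_1\times M_2}$ diagonal with nonnegative diagonal entries in nonincreasing order). For $j=1,\dots,M_2$ let $a_j=M_2^{-1/2}\,Y^{(:,j)}$, where the $j$th column $Y^{(:,j)}\in\mathbb{C}^{M_2}$ is reshaped into a $K_1\times K_2$ filter supported on $\mathbb{K}$. Let $\mathcal{W}$ and $\mathcal{W}^*$ be the analysis and synthesis operators defined by the filters $a_1,\dots,a_{M_2}$. Then $$\mathcal{W}^*\mathcal{W}(\Lambda v)=\sum_{j=1}^{M_2}\mathcal{S}_{\overline{a}_j}\bigl(\mathcal{S}_{a_j[-\cdot]}(\Lambda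 v)\bigr)=\Lambda v,$$ and for every $j=r+1,\dots,M_2$, $$\bigl(\mathcal{S}_{a_j[-\cdot]}(\Lambda v)\bigr)[k]=0\qquad\text{for all }k\in\mathbb{O}:\mathbb{K},$$ where the convolution operators act on $\Lambda_1 v$ and $\Lambda_2 v$ separately. Consequently, the right singular vectors of $\mathcal{H}(\Lambda v)$ construct a tight frame (that is, $\mathcal{W}^*\mathcal{W}$ is the identity on $\mathcal{V}_2$) under which $\Lambda v$ is sparsely represented, in the sense of the vanishing of the coefficients $\bigl(\mathcal{S}_{a_j[-\cdot]}(\Lambda v)\bigr)[k]$ for all $j=r+1,\dots,M_2$ and all $k\in\mathbb{O}:\mathbb{K}$.
   Context: Fourier transform: $\widehat{u}(\xi)=\int_{\mathbb{R}^2}u(x)e^{-2\pi i x\cdot\xi}\,dx$, and $u\in L_1(\mathbb{R}^2)$; the sets $\Omega_j$ are measurable and $1_\Omega$ is the characteristic function of $\Omega$. Grid: for $N\in\mathbb{N}$, $\mathbb{O}=\{-\lfloor N/2\rfloor,\dots,\lceil N/2\rceil-1\}^2\subset\mathbb{Z}^2$ is the $N\times N$ grid, and $\mathcal{V}_2\simeq\mathbb{C}^{|\mathbb{O}|}$ is the space of complex-valued functions on $\mathbb{O}$. Filter support: $\mathbb{K}\subset\mathbb{Z}^2$ is a rectangular $K_1\times K_2$ grid (a product of two sets of consecutive integers of sizes $K_1$ and $K_2$). The contraction is $\mathbb{O}:\mathbb{K}=\{k\in\mathbb{O}: k+j\in\mathbb{O}\text{ for all }j\in\mathbb{K}\}$,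 assumed nonempty. Put $M_1=|\mathbb{O}:\mathbb{K}|$ and $M_2=|\mathbb{K}|=K_1K_2$. Hankel matrices: for $v\in\mathcal{V}_2$, $\mathcal{H}v\in\mathbb{C}^{M_1\times M_2}$ has rows indexed by $k\in\mathbb{O}:\mathbb{K}$ and columns indexed by $l\in\mathbb{K}$, with entries $(\mathcal{H}v)[k,l]=v[k+l]$. For $w=(w_1,w_2)\in\mathcal{V}_2\times\mathcal{V}_2$, the two-fold Hankel matrix $\mathcal{H}w\in\mathbb{C}^{2M_1\times M_2}$ is obtained by stacking $\mathcal{H}w_1$ on top of $\mathcal{H}w_2$. Vectors in $\mathbb{C}^{M_2}$ are identified with filters supported on $\mathbb{K}$ through the same indexing of columns by $\mathbb{K}$. Weights: $\Lambda v=(\Lambda_1v,\Lambda_2v)\in\mathcal{V}_2\times\mathcal{V}_2$ with $(\Lambda_m v)[k]=\frac{2\pi i k_m}{L}\,v[k]$ for $k=(k_1,k_2)\in\mathbb{O}$, $m=1,2$. Convolutions: for a finitely supported filter $a$ on $\mathbb{Z}^2$, $\mathcal{S}_a:\mathcal{V}_2\to\mathcal{V}_2$ is the discrete convolution with periodic boundary condition, $(\mathcal{S}_a w)[k]=\sum_{l\in\mathbb{Z}^2}a[k-l]\,w[l]$, where $w\in\mathcal{V}_2$ is extended $N$-periodically in each coordinate to $\mathbb{Z}^2$. Here $a[-\cdot]$ denotes the flipped filter $k\mapsto a[-k]$ and $\overline{a}$ the entrywise complex conjugate. Analysis and synthesis operators: $\mathcal{W}:\mathcal{V}_2\to\mathcal{V}_2^{M_2}$,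 $\mathcal{W}w=(\mathcal{S}_{a_1[-\cdot]}w,\dots,\mathcal{S}_{a_{M_2}[-\cdot]}w)$, and $\mathcal{W}^*:\mathcal{V}_2^{M_2}\to\mathcal{V}_2$, $\mathcal{W}^*(c_1,\dots,c_{M_2})=\sum_{j=1}^{M_2}\mathcal{S}_{\overline{a}_j}c_j$. On pairs $(w_1,w_2)\in\mathcal{V}_2\times\mathcal{V}_2$, all of these operators act on $w_1$ and $w_2$ separately. *)

(* Defs.v *)
From HB Require Import structures.
From mathcomp Require Export all_boot all_order all_algebra.
From mathcomp Require Export spectral finmap.
From mathcomp Require Export all_classical all_reals all_analysis.
From mathcomp Require Export complex.
From mathcomp Require Import zify.

Set Implicit Arguments.
Unset Strict Implicit.
Unset Printing Implicit Defensive.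

Import Order.TTheory GRing.Theory Num.Theory.
Import numFieldNormedType.Exports.

Local Open Scope classical_set_scope.
Local Open Scope ring_scope.
Local Open Scope complex_scope.
Local Open Scope sesquilinear_scope.

(* [lebesgue_measure] lives on [measurableTypeR R], not on the measurable
   structure inferred on a bare [R]. *)
Notation plane R := (measurableTypeR R * measurableTypeR R)%type.

Definition lebesgue2 (R : realType) : {measure set (plane R) -> \bar R} :=
  (@lebesgue_measure R \x @lebesgue_measure R)%E.

(* The completion of the Borel sigma-algebra. *)
Definition lebesgue_measurable2 (R : realType) (A : set (plane R)) : Prop :=
  exists2 B : set (plane R), measurable B &
    (lebesgue2 R).-negligible ((A `\` B) `|` (B `\` A)).

(* [\int] is the difference of the lower integrals (suprema over simple Borel
   functions) of the positive and negative parts, which is the usual Lebesgue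
   integral also when [f] is only Lebesgue measurable. *)
Definition cintegral2 (R : realType) (f : plane R -> R[i]) : R[i] :=
  (\int[lebesgue2 R]_x complex.Re (f x)) +i* (\int[lebesgue2 R]_x complex.Im (f x)).

Definition cis (R : realType) (t : R) : R[i] := cos t +i* sin t.

Definition fourier2 (R : realType) (u : plane R -> R[i]) (xi : plane R) : R[i] :=
  cintegral2 (fun x => u x * cis (- (2 * pi * (x.1 * xi.1 + x.2 * xi.2)))).

Definition box (R : realType) (L : R) : set (plane R) :=
  `[- (L / 2), L / 2[ `*` `[- (L / 2), L / 2[.

Definition piecewise_constant (R : realType) (L : R) (J : nat)
    (alpha : 'I_J -> R[i]) (Omega : 'I_J -> set (plane R))
    (u : plane R -> R[i]) : Prop :=
  [/\ forall j, lebesgue_measurable2 (Omega j),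
      forall j, Omega j `<=` box L,
      forall i j, i != j -> Omega i `&` Omega j = set0
    & forall x, u x = \sum_(j < J) alpha j * (\1_(Omega j) x)%:C].

(* {c.1, ..., c.1 + n1 - 1} x {c.2, ..., c.2 + n2 - 1} *)
Definition zgrid (c : int * int) (n1 n2 : nat) : {fset int * int} :=
  [fset k in [seq (c.1 + i%:Z, c.2 + j%:Z)%R | i <- iota 0 n1, j <- iota 0 n2]]%fset.

Lemma mem_zgrid (c k : int * int) (n1 n2 : nat) :
  (k \in zgrid c n1 n2) =
  ((c.1 <= k.1 < c.1 + n1%:Z) && (c.2 <= k.2 < c.2 + n2%:Z)).
Proof.
rewrite !inE; apply/allpairsP/idP => [[[i j] /= []]|].
  by rewrite !mem_iota => ilt jlt -> /=; lia.
case: k => k1 k2 /= h; exists (`|(k1 - c.1)%R|%N, `|(k2 - c.2)%R|%N) => /=.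
by rewrite !mem_iota; split; [lia|lia|congr pair; lia].
Qed.

Lemma card_zgrid (c : int * int) (n1 n2 : nat) :
  #|{: zgrid c n1 n2}| = (n1 * n2)%N.
Proof.
rewrite -cardfE card_fseq undup_id ?size_allpairs ?size_iota//.
rewrite allpairs_uniq ?iota_uniq// => -[i j] [i' j'] _ _ /= [] h1 h2.
by congr pair; lia.
Qed.

Definition ogrid (N : nat) : {fset int * int} :=
  zgrid (- (N./2)%:Z, - (N./2)%:Z) N N.

Definition grid_contraction (N : nat) (K : {fset int * int}) : {fset int * int} :=
  [fset k in ogrid N | [forall j : K, (k + fsval j)%R \in ogrid N]]%fset.

Definition V2 (R : realType) (N : nat) := {ffun ogrid N -> R[i]}.

(* [v] extended by zero outside [A]. *)
Definition at_ (R : realType) (A : {fset int * int}) (v : A -> R[i])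
    (k : int * int) : R[i] :=
  if insub k is Some k' then v k' else 0.

(* The representative of [k] modulo N in [ogrid N] (for N > 0). *)
Definition wrap (N : nat) (k : int * int) : int * int :=
  (((k.1 + (N./2)%:Z) %% N%:Z)%Z - (N./2)%:Z,
   ((k.2 + (N./2)%:Z) %% N%:Z)%Z - (N./2)%:Z).

Definition periodize (R : realType) (N : nat) (w : V2 R N) (k : int * int) : R[i] :=
  at_ w (wrap N k).

Definition flip (R : realType) (a : int * int -> R[i]) : int * int -> R[i] :=
  fun k => a (- k).

Definition conjf (R : realType) (a : int * int -> R[i]) : int * int -> R[i] :=
  fun k => (a k)^*%R.

(* The sum over Z^2 is finitely supported as soon as [a] is. *)
Definition conv (R : realType) (N : nat) (a : int * int -> R[i]) (w : V2 R N) :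
    V2 R N :=
  [ffun k : ogrid N => \sum_(l \in [set: int * int]) a (fsval k - l) * periodize w l].

Definition conv2 (R : realType) (N : nat) (a : int * int -> R[i])
    (w : V2 R N * V2 R N) : V2 R N * V2 R N :=
  (conv a w.1, conv a w.2).

Definition analysis (R : realType) (N M : nat) (a : 'I_M -> int * int -> R[i])
    (w : V2 R N) : {ffun 'I_M -> V2 R N} :=
  [ffun j => conv (flip (a j)) w].

Definition synthesis (R : realType) (N M : nat) (a : 'I_M -> int * int -> R[i])
    (c : {ffun 'I_M -> V2 R N}) : V2 R N :=
  \sum_(j < M) conv (conjf (a j)) (c j).

Definition analysis2 (R : realType) (N M : nat) (a : 'I_M -> int * int -> R[i])
    (w : V2 R N * V2 R N) : {ffun 'I_M -> V2 R N} * {ffun 'I_M -> V2 R N} :=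
  (analysis a w.1, analysis a w.2).

Definition synthesis2 (R : realType) (N M : nat) (a : 'I_M -> int * int -> R[i])
    (c : {ffun 'I_M -> V2 R N} * {ffun 'I_M -> V2 R N}) : V2 R N * V2 R N :=
  (synthesis a c.1, synthesis a c.2).

Definition weight (R : realType) (L : R) (N : nat) (v : V2 R N) :
    V2 R N * V2 R N :=
  ([ffun k : ogrid N => (0 +i* (2 * pi * (fsval k).1%:~R / L)) * v k],
   [ffun k : ogrid N => (0 +i* (2 * pi * (fsval k).2%:~R / L)) * v k]).

(* Rows and columns are numbered by the enumerations of the two index sets. *)
Definition hankel (R : realType) (N : nat) (K : {fset int * int}) (v : V2 R N) :
    'M[R[i]]_(#|{: grid_contraction N K}|, #|{: K}|) :=
  \matrix_(i, j) at_ v (fsval (enum_val i) + fsval (enum_val j)).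

Definition hankel2 (R : realType) (N : nat) (K : {fset int * int})
    (w : V2 R N * V2 R N) :
    'M[R[i]]_(#|{: grid_contraction N K}| + #|{: grid_contraction N K}|, #|{: K}|) :=
  col_mx (hankel K w.1) (hankel K w.2).

Definition filter_of_col (R : realType) (K : {fset int * int})
    (y : 'cV[R[i]]_#|{: K}|) : int * int -> R[i] :=
  at_ (fun l : K => y (enum_rank l) 0).

Definition full_svd (R : realType) (m n : nat) (A : 'M[R[i]]_(m, n))
    (X : 'M[R[i]]_m) (Sigma : 'M[R[i]]_(m, n)) (Y : 'M[R[i]]_n) : Prop :=
  [/\ X \is unitarymx, Y \is unitarymx, A = X *m Sigma *m Y ^t*
    & [/\ is_diag_mx Sigma,
      forall (i : 'I_m) (j : 'I_n), i = j :> nat -> 0 <= Sigma i j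
    & forall (i i' : 'I_m) (j j' : 'I_n), i = j :> nat -> i' = j' :> nat ->
        (i <= i')%N -> Sigma i' j' <= Sigma i j]].

Definition tight_frame (R : realType) (N M : nat)
    (a : 'I_M -> int * int -> R[i]) : Prop :=
  forall w : V2 R N, synthesis a (analysis a w) = w.

(* Main.v *)
Require Import Defs.
From mathcomp Require Import zify.

(** Both conclusions are linear algebra over the grid: the frame identity comes
    from the unitarity of [Y], the vanishing coefficients from the kernel of the
    Hankel matrix.

    Tight frame.  Composing the flipped filters with their conjugates gives
    [W^* W w [k] = sum_(m, n) (sum_j a_j[n] conj(a_j[m])) w[k - m + n]], with
    [w] extended periodically.  The columns of [Y] are the [sqrt M2 a_j], so
    the orthonormality of its rows makes the inner sum [1/M2] when [n = m] and
    [0] otherwise; the [M2] diagonal terms add up to [w[k]]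
    ([tight_frame_orthogonal]).  Nesting two convolutions is legitimate because
    a convolution of a periodic array is again periodic
    ([periodize_conv_flip]).

    Vanishing coefficients.  On the contraction of the grid by [K] the shifts
    [k + m] never leave the grid, so no wrap-around occurs and the coefficients
    of [w] against the filter [y] are the entries of the Hankel matrix of [w]
    times [y] ([conv_flip_hankel]).  The right singular vectors beyond the rank
    lie in the kernel of the matrix ([svd_col_eq0]), and the kernel of the
    two-fold Hankel matrix is the intersection of the kernels of its two
    blocks. *)

Import Order.TTheory GRing.Theory Num.Theory.
Import numFieldNormedType.Exports.

Local Open Scope ring_scope.
Local Open Scope complex_scope.

Lemma rank_mxsub (F : fieldType) (m n p q : nat) (f : 'I_p -> 'I_m)
    (g : 'I_q -> 'I_n) (A : 'M[F]_(m, n)) :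
  (\rank (mxsub f g A) <= \rank A)%N.
Proof.
have -> : mxsub f g A = rowsub f 1%:M *m (A *m colsub g 1%:M).
  rewrite mulmx_colsub mulmx1 mul_rowsub_mx mul1mx.
  by apply/matrixP => i j; rewrite !mxE.
exact: leq_trans (mxrankM_maxr _ _) (mxrankM_maxl _ _).
Qed.

(** The leading [p * p] block is diagonal with nonzero determinant, and a
    submatrix cannot have larger rank than the whole. *)
Lemma rank_ge_diag (F : fieldType) (m n p : nat) (S : 'M[F]_(m, n))
    (pm : (p <= m)%N) (pn : (p <= n)%N) :
  is_diag_mx S ->
  (forall t : 'I_p, S (widen_ord pm t) (widen_ord pn t) != 0) ->
  (p <= \rank S)%N.
Proof.
move=> /is_diag_mxP Sdiag Snz.
pose D := mxsub (widen_ord pm) (widen_ord pn) S.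
pose d := \row_(t < p) S (widen_ord pm t) (widen_ord pn t).
have DE : D = diag_mx d.
  apply/matrixP => s t; rewrite !mxE; have [->|st] := eqVneq s t; first by [].
  by rewrite mulr0n Sdiag.
have Du : D \in unitmx.
  rewrite DE unitmxE det_diag unitfE; apply/prodf_neq0 => t _.
  by rewrite mxE.
by rewrite -[X in (X <= _)%N](mxrank_unit Du) rank_mxsub.
Qed.

(** [A *m Y = X *m S], so it is enough that column [j] of [S] vanish.  As the
    diagonal of [S] is nonnegative and nonincreasing, a nonzero entry in
    position [j] would force [j + 1] nonzero diagonal entries, hence rank at
    least [j + 1]. *)
Lemma svd_col_eq0 (R : realType) (m n : nat) (A : 'M[R[i]]_(m, n))
    (X : 'M[R[i]]_m) (S : 'M[R[i]]_(m, n)) (Y : 'M[R[i]]_n) :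
  full_svd A X S Y ->
  forall j : 'I_n, (\rank A <= j)%N -> A *m col j Y = 0.
Proof.
move=> [Xu Yu AE [Sdiag S0 Smono]] j rj.
have rankS : \rank S = \rank A.
  rewrite AE mxrankMfree ?row_free_unit; last first.
    by rewrite unitarymx_unit // trmxC_unitary.
  by rewrite eqmxMfull // row_full_unit unitarymx_unit.
suff col0 : col j S = 0.
  by rewrite colE mulmxA AE mulmxKtV // -mulmxA -colE col0 mulmx0.
apply/colP => i; rewrite !mxE; apply/eqP.
have [ij|nij] := eqVneq (i : nat) (j : nat); last by move/is_diag_mxP: Sdiag => ->.
apply: contraLR rj => Sij; rewrite -ltnNge -rankS.
have jm : (j.+1 <= m)%N by rewrite -ij.
apply: (@rank_ge_diag _ _ _ j.+1 S jm (ltn_ord j)) => // t.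
rewrite gt_eqF //; apply: lt_le_trans (Smono _ i _ j _ ij _) => //.
  by rewrite lt_def Sij S0.
by rewrite /= ij -ltnS ltn_ord.
Qed.

(** Turns the sum over the whole lattice that defines a convolution into a sum
    over the support [K] of the filter, after a bijective change of variable. *)
Lemma fsum_reindex_support (V : nmodType) (T U : choiceType) (K : {fset T})
    (h : T -> U) (g : U -> T) (F : U -> V) :
  cancel h g -> cancel g h -> (forall l, g l \notin K -> F l = 0) ->
  (\sum_(l \in [set: U]) F l)%R = \sum_(m : K) F (h (fsval m)).
Proof.
move=> hK gK F0; rewrite (@fsbigTE _ _ _ _ [fset h m | m in K]%fset) => [|l lK].
  rewrite big_imfset /=; last by move=> x y _ _; apply: (can_inj hK).
  by rewrite big_seq_fsetE.
by apply: F0; apply: contra lK => glK; apply/imfsetP; exists (g l).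
Qed.

Section Filters.
Variables (R : realType) (N : nat) (K : {fset int * int}).
Implicit Types (a : int * int -> R[i]) (w : V2 R N) (y : 'cV[R[i]]_#|{: K}|).

Lemma at_fsval (A : {fset int * int}) (f : A -> R[i]) (k : A) :
  at_ f (fsval k) = f k.
Proof. by rewrite /at_ valK. Qed.

Lemma at_out (A : {fset int * int}) (f : A -> R[i]) (k : int * int) :
  k \notin A -> at_ f k = 0.
Proof. by move=> kA; rewrite /at_ insubN. Qed.

Lemma convE a w (k : ogrid N) : (forall m, m \notin K -> a m = 0) ->
  conv a w k = \sum_(m : K) a (fsval m) * periodize w (fsval k - fsval m).
Proof.
move=> a0; rewrite ffunE.
rewrite (@fsum_reindex_support _ _ _ K (fun m => fsval k - m)
  (fun l => fsval k - l)).
- by apply: eq_bigr => m _; rewrite subKr.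
- by move=> m; rewrite subKr.
- by move=> m; rewrite subKr.
- by move=> l lK; rewrite a0 ?mul0r.
Qed.

Lemma conv_flipE a w (k : ogrid N) : (forall m, m \notin K -> a m = 0) ->
  conv (flip a) w k = \sum_(m : K) a (fsval m) * periodize w (fsval k + fsval m).
Proof.
move=> a0; rewrite ffunE.
rewrite (@fsum_reindex_support _ _ _ K (fun m => fsval k + m)
  (fun l => l - fsval k)).
- by apply: eq_bigr => m _; rewrite /flip opprB addrAC subrr add0r.
- by move=> m; rewrite addrC addKr.
- by move=> m; rewrite addrC subrK.
- by move=> l lK; rewrite /flip opprB a0 ?mul0r.
Qed.

Lemma wrap_id k : k \in ogrid N -> wrap N k = k.
Proof.
case: k => k1 k2; rewrite mem_zgrid /wrap /= => kN.
by rewrite !modz_small; [congr pair; lia|lia|lia].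
Qed.

Lemma wrap_ogrid k : (0 < N)%N -> wrap N k \in ogrid N.
Proof.
move=> N0; rewrite mem_zgrid /wrap /=.
have N0' : (N%:Z != 0)%R by lia.
have := modz_ge0 (k.1 + (N./2)%:Z) N0'; have := modz_ge0 (k.2 + (N./2)%:Z) N0'.
have N0'' : (0 < N%:Z)%R by lia.
have := ltz_pmod (k.1 + (N./2)%:Z) N0''; have := ltz_pmod (k.2 + (N./2)%:Z) N0''.
lia.
Qed.

(** Reduction modulo [N] before a shift is harmless: this is the compatibility
    of the periodic extension with translations. *)
Lemma wrap_wrapD k l : wrap N (wrap N k + l) = wrap N (k + l).
Proof.
have mod_shift (x y h : int) :
    ((((x + h) %% N)%Z - h + y + h) %% N)%Z = ((x + y + h) %% N)%Z.
  by rewrite addrAC subrK modzDml addrAC.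
by rewrite /wrap /= !mod_shift.
Qed.

Lemma periodize_ogrid w k : k \in ogrid N -> periodize w k = at_ w k.
Proof. by move=> kN; rewrite /periodize wrap_id. Qed.

(** [conv_flipE] with [k] ranging over the whole lattice: the periodic extension
    commutes with convolution. *)
Lemma periodize_conv_flip a w k : (0 < N)%N -> (forall m, m \notin K -> a m = 0) ->
  periodize (conv (flip a) w) k =
    \sum_(m : K) a (fsval m) * periodize w (k + fsval m).
Proof.
move=> N0 a0; rewrite /periodize.
have -> : wrap N k = fsval [` wrap_ogrid k N0]%fset by [].
rewrite at_fsval conv_flipE //; apply: eq_bigr => m _.
by rewrite /periodize wrap_wrapD.
Qed.

(** The hypothesis says that the matrix with rows the [a_j] restricted to [K]
    has orthogonal columns of squared norm [s].  In the double sum over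
    [m, n \in K] only the terms [n = m] survive, where the shifts [- m] and
    [+ n] cancel, leaving [#|K| * s * w k]. *)
Lemma tight_frame_orthogonal (M : nat) (a : 'I_M -> int * int -> R[i]) (s : R[i]) :
  (0 < N)%N -> (forall j m, m \notin K -> a j m = 0) ->
  (forall m n : K,
    \sum_(j < M) a j (fsval n) * (a j (fsval m))^*%R = s *+ (n == m)) ->
  #|{: K}|%:R * s = 1 -> tight_frame N a.
Proof.
move=> N0 a0 orth sK w; apply/ffunP => k; rewrite /synthesis sum_ffunE.
under eq_bigr => j _.
  rewrite convE; last by move=> m mK; rewrite /conjf a0 ?rmorph0.
  rewrite ffunE.
  under eq_bigr => m _ do rewrite (periodize_conv_flip _ _ _ N0 (a0 j)) mulr_sumr.
  over.
rewrite exchange_big /=.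
transitivity (\sum_(m : K) s * w k).
  apply: eq_bigr => m _; rewrite exchange_big /=.
  rewrite (bigD1 m) //= [X in _ + X]big1 => [|n nm].
    rewrite addr0 subrK periodize_ogrid ?fsvalP // at_fsval.
    have := orth m m; rewrite eqxx mulr1n => <-; rewrite mulr_suml.
    by apply: eq_bigr => j _; rewrite mulrCA mulrA.
  have := orth m n; rewrite (negbTE nm) mulr0n => o0.
  rewrite -[RHS](mul0r (periodize w (fsval k - fsval m + fsval n))).
  rewrite -[X in _ = X * _]o0 mulr_suml.
  by apply: eq_bigr => j _; rewrite mulrCA mulrA.
by rewrite sumr_const -mulr_natl mulrA sK mul1r.
Qed.

Lemma filter_of_colE y (m : K) : filter_of_col y (fsval m) = y (enum_rank m) 0.
Proof. by rewrite /filter_of_col at_fsval. Qed.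

(** The contraction is exactly the set of [k] for which [k + m] stays in the grid
    for all [m] in [K], so that the periodic extension of [w] is never used
    outside the grid and the coefficients are a Hankel matrix-vector product. *)
Lemma conv_flip_hankel y w (k : ogrid N)
    (kC : fsval k \in grid_contraction N K) :
  conv (flip (filter_of_col y)) w k =
    (hankel K w *m y) (enum_rank [` kC]%fset) 0.
Proof.
rewrite (conv_flipE (filter_of_col y) w k (at_out _ _)) mxE.
rewrite (reindex (@enum_val _ (mem {: K}))) /=; last first.
  exact: onW_bij (enum_val_bij _).
apply: eq_bigr => i _; rewrite filter_of_colE enum_valK mxE enum_rankK mulrC.
rewrite periodize_ogrid //.
by have := kC; rewrite 2!inE => /andP[_ /forallP]; apply.
Qed.

End Filters.

Theorem theorem3p2
  (R : realType) (L : R) (hL : 0 < L)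
  (J : nat) (alpha : 'I_J -> R[i]) (Omega : 'I_J -> set (plane R))
  (u : plane R -> R[i])
  (hu : piecewise_constant L alpha Omega u)
  (hmin : forall (J' : nat) (alpha' : 'I_J' -> R[i])
      (Omega' : 'I_J' -> set (plane R)),
    piecewise_constant L alpha' Omega' u -> (J <= J')%N)
  (N : nat) (v : V2 R N)
  (hv : forall k : ogrid N,
    v k = fourier2 u ((fsval k).1%:~R / L, (fsval k).2%:~R / L))
  (c : int * int) (K1 K2 : nat) (K : {fset int * int})
  (hK : K = zgrid c K1 K2)
  (hne : grid_contraction N K != fset0)
  (r : nat) (hr : \rank (hankel2 K (weight L v)) = r)
  (hlt : (r < minn (2 * #|{: grid_contraction N K}|) #|{: K}|)%N)
  (X : 'M[R[i]]_(#|{: grid_contraction N K}| + #|{: grid_contraction N K}|))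
  (Sigma : 'M[R[i]]_(#|{: grid_contraction N K}| + #|{: grid_contraction N K}|, #|{: K}|))
  (Y : 'M[R[i]]_#|{: K}|)
  (hsvd : full_svd (hankel2 K (weight L v)) X Sigma Y)
  (a : 'I_#|{: K}| -> int * int -> R[i])
  (ha : forall j, a j =
    filter_of_col (((Num.sqrt (#|{: K}|%:R : R))^-1)%:C *: col j Y)) :
  [/\ synthesis2 a (analysis2 a (weight L v)) =
        \sum_(j < #|{: K}|) conv2 (conjf (a j)) (conv2 (flip (a j)) (weight L v)),
      \sum_(j < #|{: K}|) conv2 (conjf (a j)) (conv2 (flip (a j)) (weight L v)) =
        weight L v,
      forall j : 'I_#|{: K}|, (r <= j)%N ->
        forall k : ogrid N, fsval k \in grid_contraction N K ->
          (conv2 (flip (a j)) (weight L v)).1 k = 0 /\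
          (conv2 (flip (a j)) (weight L v)).2 k = 0
    & tight_frame N a].
Proof.
have K0 : (0 < #|{: K}|)%N by move: hlt; rewrite leq_min => /andP[_]; lia.
have N0 : (0 < N)%N.
  have /fset0Pn[k] := hne; rewrite 2!inE => /andP[+ _].
  by rewrite mem_zgrid; lia.
have frame : tight_frame N a.
  pose s : R[i] := (#|{: K}|%:R)^-1.
  have sqrtE : ((Num.sqrt (#|{: K}|%:R : R))^-1)%:C ^+ 2 = s.
    by rewrite -rmorphXn /= exprVn sqr_sqrtr ?ler0n // fmorphV rmorph_nat.
  apply: (@tight_frame_orthogonal _ _ K _ _ s) => //.
  - by move=> j m mK; rewrite ha /filter_of_col at_out.
  - move=> m n; case: hsvd => _ /unitarymxP YY _ _.
    have := congr1 (fun B : 'M[R[i]]_#|{: K}| => B (enum_rank n) (enum_rank m)) YY.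
    rewrite !mxE (inj_eq enum_rank_inj) => Ynm.
    rewrite -[RHS]mulr_natr -Ynm mulr_sumr; apply: eq_bigr => j _.
    rewrite ha !filter_of_colE !mxE rmorphM /= -sqrtE expr2.
    rewrite (_ : ((_%:C)^*)%R = ((Num.sqrt (#|{: K}|%:R : R))^-1)%:C); last first.
      exact: conjc_real.
    by rewrite mulrACA.
  - by rewrite mulfV // pnatr_eq0 -lt0n.
have sumE : synthesis2 a (analysis2 a (weight L v)) =
    \sum_(j < #|{: K}|) conv2 (conjf (a j)) (conv2 (flip (a j)) (weight L v)).
  rewrite [RHS]surjective_pairing raddf_sum (raddf_sum snd) /=.
  by congr pair; apply: eq_bigr => j _; rewrite ffunE.
split=> //.
  by rewrite -sumE /synthesis2 /analysis2 !frame -surjective_pairing.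
move=> j rj k kC; rewrite /= ha !(conv_flip_hankel _ _ _ _ _ _ kC) -!scalemxAr.
have := svd_col_eq0 _ _ _ _ _ _ _ hsvd j; rewrite hr => /(_ rj).
rewrite /hankel2 mul_col_mx -[0 in RHS]col_mx0 => /eq_col_mx[-> ->].
by rewrite !scaler0 !mxE.
Qed.
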